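(* Let $X$ be a closed convex subset of a finite-dimensional vector space, let $g:X\to\mathbb{R}^n$ be a $\mu$-relatively strongly monotone ($\mu>0$) and $L$-smooth operator, and let $z_*$ be the exact solution of the Minty variational inequality for $g$ on $X$. Let $(z_k)$, $(L_k)$ be generated by the adaptive first-order method described in the context. Then for every $k\geqslant0$, $$V(z_*,z_{k+1})\leqslant\prod_{i=0}^{k}\left(1+\frac{\mu}{L_{i+1}}\right)^{-1}V(z_*,z_0)$$ and $$V(z_*,z_{k+1})\leqslant\left(1+\frac{\mu}{2L}\right)^{-(k+1)}V(z_*,z_0).$$
   Context: $d$ is a prox-function: continuously differentiable and convex on the ambient finite-dimensional space. $V(y,x)=d(y)-d(x)-\langle\nabla d(x),y-x\rangle$ is its Bregman divergence. Minty variational inequality: find $z_*\in X$ with $\langle g(x),z_*-x\rangle\leqslant0$ for all $x\in X$. $g$ is $\mu$-relatively strongly monotone if $\mu V(y,x)+\mu V(x,y)\leqslant\langle g(y)-g(x),y-x\rangle$ for all $x,y\in X$. $g$ is $L$-smooth ($L>0$) if $\langle g(y)-g(z),x-z\rangle\leqslant LV(x,z)+LV(z,y)$ for all $x,y,z\in X$. Adaptive first-order method. Input: $L_0>0$, $\mu>0$, $d$, $V$. Set $z_0=\arg\min_{u\in X}d(u)$. For $k=0,1,2,\dots$: find the smallest integer $i_k\geqslant0$ such that, with $L_{k+1}=2^{i_k-1}L_k$, $$w_k=\arg\min_{y\in X}\left\{\left\langle\tfrac{1}{L_{k+1}}g(z_k),y\right\rangle+V(y,z_k)\right\},$$ $$z_{k+1}=\arg\min_{z\in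 X}\left\{\left\langle\tfrac{1}{L_{k+1}}g(w_k),z\right\rangle+V(z,z_k)+\tfrac{\mu}{L_{k+1}}V(z,w_k)\right\},$$ one has $$\langle g(z_k)-g(w_k),z_{k+1}-w_k\rangle\leqslant L_{k+1}\big(V(w_k,z_k)+V(z_{k+1},w_k)\big).$$
   Formalization: The second bound is proved under the extra condition L_0 ≤ 4L; without it the bound is false (X=ℝ, d=x²/2, g(x)=x−1, μ=L=1, z_0=0, L_0=100, k=0). The first bound is proved without this condition. *)

(* Defs.v *)
From HB Require Import structures.
From mathcomp Require Import all_boot all_order all_algebra.
From mathcomp Require Import all_classical all_reals all_analysis.

Set Implicit Arguments.
Unset Strict Implicit.
Unset Printing Implicit Defensive.

Import Order.TTheory GRing.Theory Num.Theory.
Import numFieldNormedType.Exports.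

Local Open Scope classical_set_scope.
Local Open Scope ring_scope.

Definition dotp (R : realType) (n : nat) (u v : 'rV[R]_n) : R :=
  \sum_(i < n) u 0 i * v 0 i.

Definition grad (R : realType) (n : nat) (d : 'rV[R]_n -> R) (x : 'rV[R]_n) :
    'rV[R]_n :=
  \row_(i < n) 'd d x (delta_mx 0 i).

Definition prox_function (R : realType) (n : nat) (d : 'rV[R]_n -> R) : Prop :=
  [/\ forall x, differentiable d x,
      continuous (grad d)
    & convex_function setT d].

Definition bregman (R : realType) (n : nat) (d : 'rV[R]_n -> R)
    (y x : 'rV[R]_n) : R :=
  d y - d x - dotp (grad d x) (y - x).

(* An operator on X is a total map on the ambient space of which only the
   values on X are ever constrained. *)

Definition minty_solution (R : realType) (n : nat) (X : set 'rV[R]_n)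
    (g : 'rV[R]_n -> 'rV[R]_n) (zs : 'rV[R]_n) : Prop :=
  X zs /\ forall x, X x -> dotp (g x) (zs - x) <= 0.

Definition rel_strongly_monotone (R : realType) (n : nat) (X : set 'rV[R]_n)
    (d : 'rV[R]_n -> R) (mu : R) (g : 'rV[R]_n -> 'rV[R]_n) : Prop :=
  forall x y, X x -> X y ->
    mu * bregman d y x + mu * bregman d x y <= dotp (g y - g x) (y - x).

Definition rel_smooth (R : realType) (n : nat) (X : set 'rV[R]_n)
    (d : 'rV[R]_n -> R) (L : R) (g : 'rV[R]_n -> 'rV[R]_n) : Prop :=
  forall x y z, X x -> X y -> X z ->
    dotp (g y - g z) (x - z) <= L * bregman d x z + L * bregman d z y.

Definition is_argmin (R : realType) (n : nat) (X : set 'rV[R]_n)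
    (f : 'rV[R]_n -> R) (x : 'rV[R]_n) : Prop :=
  X x /\ forall y, X y -> f x <= f y.

(* [w] and [z'] are the two points computed from the iterate [z] with the
   parameter [L]. Since [d] is only assumed convex, minimizers need be neither
   unique nor existent, hence a relation: any choice of minimizers is
   allowed. *)
Definition trial (R : realType) (n : nat) (X : set 'rV[R]_n)
    (d : 'rV[R]_n -> R) (g : 'rV[R]_n -> 'rV[R]_n) (mu L : R)
    (z w z' : 'rV[R]_n) : Prop :=
  is_argmin X (fun y => dotp (L^-1 *: g z) y + bregman d y z) w /\
  is_argmin X (fun u => dotp (L^-1 *: g w) u + bregman d u z
                        + mu / L * bregman d u w) z'.

Definition accepted (R : realType) (n : nat)
    (d : 'rV[R]_n -> R) (g : 'rV[R]_n -> 'rV[R]_n) (L : R)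
    (z w z' : 'rV[R]_n) : Prop :=
  dotp (g z - g w) (z' - w) <= L * (bregman d w z + bregman d z' w).

(* [2 ^+ i / 2] is 2^(i-1), the value 1/2 being taken at i = 0. Minimality of
   [i] is that of a run of the line search: every smaller [j] has been tried,
   and the points computed in that trial failed the test. *)
Definition adaptive_step (R : realType) (n : nat) (X : set 'rV[R]_n)
    (d : 'rV[R]_n -> R) (g : 'rV[R]_n -> 'rV[R]_n) (mu Lk Lk1 : R)
    (z w z' : 'rV[R]_n) : Prop :=
  exists i : nat,
    [/\ Lk1 = 2 ^+ i / 2 * Lk,
        trial X d g mu Lk1 z w z',
        accepted d g Lk1 z w z'
      & forall j : nat, (j < i)%N ->
          exists w0 z0 : 'rV[R]_n,
            trial X d g mu (2 ^+ j / 2 * Lk) z w0 z0 /\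
            ~ accepted d g (2 ^+ j / 2 * Lk) z w0 z0].

Definition adaptive_method (R : realType) (n : nat) (X : set 'rV[R]_n)
    (d : 'rV[R]_n -> R) (g : 'rV[R]_n -> 'rV[R]_n) (mu L0 : R)
    (z w : nat -> 'rV[R]_n) (Ls : nat -> R) : Prop :=
  [/\ is_argmin X d (z 0%N),
      Ls 0%N = L0
    & forall k : nat,
        adaptive_step X d g mu (Ls k) (Ls k.+1) (z k) (w k) (z k.+1)].

(* Main.v *)
(* First-order optimality of the two prox steps at [x = zs], the acceptance test
   and the three-point identity for Bregman divergences give
   [(1 + mu/L') V(zs, z') <= V(zs, z) + mu/L' (V(zs, w) - V(z', w))
      - <g w, w - zs> / L'].
   A Minty solution of a relatively smooth operator is also a Stampacchia
   solution, so strong monotonicity yields [mu V(zs, w) <= <g w, w - zs>], and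
   each step contracts [V(zs, _)] by [(1 + mu/L')^-1]. Relative smoothness
   makes the acceptance test hold as soon as [L' >= L], so [Lk <= 4 L]
   propagates to [L' <= 2 L]. *)
Require Import Defs.
From HB Require Import structures.
From mathcomp Require Import all_boot all_order all_algebra ring lra.
From mathcomp Require Import all_classical all_reals all_analysis.

Set Implicit Arguments.
Unset Strict Implicit.
Unset Printing Implicit Defensive.

Import Order.TTheory GRing.Theory Num.Theory.
Import numFieldNormedType.Exports.

Local Open Scope classical_set_scope.
Local Open Scope ring_scope.

Section DotProduct.
Context {R : realType} {n : nat}.
Implicit Types (u v x : 'rV[R]_n) (c : R).

Lemma dotpDl u v x : dotp (u + v) x = dotp u x + dotp v x.
Proof. by rewrite /dotp -big_split; apply: eq_bigr => i _; rewrite mxE mulrDl. Qed.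

Lemma dotpZl c u x : dotp (c *: u) x = c * dotp u x.
Proof. by rewrite /dotp mulr_sumr; apply: eq_bigr => i _; rewrite mxE mulrA. Qed.

Lemma dotpC u v : dotp u v = dotp v u.
Proof. by apply: eq_bigr => i _; rewrite mulrC. Qed.

Lemma dotpNl u x : dotp (- u) x = - dotp u x.
Proof. by rewrite -scaleN1r dotpZl mulN1r. Qed.

Lemma dotpDr u x v : dotp u (x + v) = dotp u x + dotp u v.
Proof. by rewrite dotpC dotpDl !(dotpC _ u). Qed.

Lemma dotpNr u x : dotp u (- x) = - dotp u x.
Proof. by rewrite dotpC dotpNl dotpC. Qed.

Lemma dotpZr c u x : dotp u (c *: x) = c * dotp u x.
Proof. by rewrite dotpC dotpZl dotpC. Qed.

Definition dotpE := (dotpDl, dotpNl, dotpZl, dotpDr, dotpNr, dotpZr).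

Lemma cvg_dotpl {T : Type} {F : set_system T} {FF : Filter F}
    (f : T -> 'rV[R]_n) (a v : 'rV[R]_n) :
  f @ F --> a -> dotp (f x) v @[x --> F] --> dotp a v.
Proof.
move=> fa; apply: cvg_big; first exact: add_continuous.
move=> i _; apply: cvgMr_tmp.
exact: (continuous_cvg _ (@coord_continuous _ _ _ 0 i a) fa).
Qed.

End DotProduct.

Section Differentiable.
Context {R : realType} {n : nat} {d : 'rV[R]_n -> R}.
Implicit Types x y v : 'rV[R]_n.

Lemma diff_dotp_grad x v : differentiable d x -> 'd d x v = dotp (grad d x) v.
Proof.
move=> dx; rewrite [in LHS](row_sum_delta v) linear_sum /dotp.
by apply: eq_bigr => i _; rewrite linearZ/= mxE mulrC.
Qed.

(** The limit is one-sided because a segment issued from a point of [X] is only known to stay in [X]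
    for [t] in [[0, 1]]. *)
Lemma cvg_difference_quotient x v : differentiable d x ->
  t^-1 * (d (x + t *: v) - d x) @[t --> 0^'+] --> dotp (grad d x) v.
Proof.
move=> dx; rewrite -diff_dotp_grad// -deriveE//.
have /cvg_dnbhs_at_right : derivable d x v by exact: diff_derivable.
rewrite /derive /shift/=; under eq_fun do rewrite [_ + x]addrC. exact.
Qed.

End Differentiable.

Lemma convex_set_segment {R : realType} {n : nat} (X : set 'rV[R]_n)
    (x y : 'rV[R]_n) (t : R) :
  convex_set X -> X x -> X y -> 0 <= t <= 1 -> X (x + t *: (y - x)).
Proof.
move=> cX Xx Xy /andP[t0 t1].
have := cX y x (Itv01 t0 t1) (mem_set Xy) (mem_set Xx); rewrite inE.
rewrite /conv/= /unstable.onem scalerBl scale1r scalerBr.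
by rewrite addrCA.
Qed.

Lemma near_right01 (R : realType) : \forall t \near (0 : R)^'+, 0 < t <= 1.
Proof.
by near=> t; apply/andP; split; near: t;
  [exact: nbhs_right_gt|exact: nbhs_right_le].
Unshelve. all: by end_near. Qed.

(** Convexity bounds each difference quotient along [y - x] with [0 < t <= 1] by [d y - d x]; the
    bound survives [t --> 0]. *)
Lemma bregman_ge0 {R : realType} {n : nat} (d : 'rV[R]_n -> R)
    (x y : 'rV[R]_n) : prox_function d -> 0 <= bregman d y x.
Proof.
move=> [dd _ cd]; rewrite /bregman subr_ge0.
apply: (cvgr_to_le (cvg_difference_quotient (v := y - x) (dd x))).
apply: filterS (near_right01 R) => t /andP[t0 t1].
have := cd (Itv01 (ltW t0) t1) y x (mem_set I) (mem_set I).
rewrite convRE /conv/= /unstable.onem => h.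
rewrite mulrC ler_pdivrMr//.
have -> : x + t *: (y - x) = t *: y + (1 - t) *: x.
  by rewrite scalerBl scale1r scalerBr addrCA.
lra.
Qed.

(** Compare [x] with [x + t (y - x)], divide by [t] and let [t] tend to 0 from the right. Up to an
    additive constant, both prox objectives have the form [dotp a u + c * d u]. *)
Lemma argmin_first_order {R : realType} {n : nat} (X : set 'rV[R]_n)
    (d : 'rV[R]_n -> R) (a x y : 'rV[R]_n) (c : R) :
  convex_set X -> differentiable d x ->
  is_argmin X (fun u => dotp a u + c * d u) x -> X y ->
  0 <= dotp (a + c *: grad d x) (y - x).
Proof.
move=> cX dx [Xx xmin] Xy; rewrite dotpDl dotpZl.
have lim : dotp a (y - x) + c * (t^-1 * (d (x + t *: (y - x)) - d x))
    @[t --> 0^'+] --> dotp a (y - x) + c * dotp (grad d x) (y - x).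
  apply: cvgD; first exact: cvg_cst.
  by apply: cvgMl_tmp; exact: cvg_difference_quotient.
apply: (cvgr_to_ge lim); apply: filterS (near_right01 R) => t /andP[t0 t1] /=.
have := xmin _ (convex_set_segment cX Xx Xy (introT andP (conj (ltW t0) t1))).
rewrite dotpDr dotpZr => h.
rewrite -(pmulr_rge0 _ t0) mulrDr [t * (c * _)]mulrCA mulVKf ?gt_eqF//.
lra.
Qed.

(* No continuity of [g] is needed: with [y = zs + t (w - zs)], smoothness at
   [(y, y, zs)] bounds [t <g y - g zs, w - zs>] by
   [L (V(y, zs) + V(zs, y)) = L t <grad d y - grad d zs, w - zs>]. *)
Lemma minty_stampacchia {R : realType} {n : nat} (X : set 'rV[R]_n)
    (d : 'rV[R]_n -> R) (g : 'rV[R]_n -> 'rV[R]_n) (L : R)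
    (zs w : 'rV[R]_n) :
  convex_set X -> continuous (grad d) -> rel_smooth X d L g ->
  minty_solution X g zs -> X w -> 0 <= dotp (g zs) (w - zs).
Proof.
move=> cX cgrad gL [Xzs sol] Xw; move vE: (w - zs) => v.
pose xt (t : R) := zs + t *: v.
have xt0 : xt t @[t --> 0^'+] --> zs.
  rewrite -[zs in X in _ --> X]addr0 -(scale0r v).
  apply: cvgD; first exact: cvg_cst.
  by apply: cvgZr_tmp; apply: cvg_at_right_filter; exact: cvg_id.
(* The factor of [L] vanishes in the limit by continuity of [grad d]. Before the limit the
   expression is nonnegative: the Minty inequality at [xt t] gives [0 <= dotp (g (xt t)) v], and
   smoothness pays for replacing [g (xt t)] by [g zs]. *)
have lim : dotp (g zs) v + L * (dotp (grad d (xt t)) v - dotp (grad d zs) v)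
    @[t --> 0^'+] --> dotp (g zs) v.
  rewrite -[X in _ --> X](_ : dotp (g zs) v + L *
    (dotp (grad d zs) v - dotp (grad d zs) v) = _); last by ring.
  apply: cvgD; first exact: cvg_cst.
  apply: cvgMl_tmp; apply: cvgB; last exact: cvg_cst.
  by apply: cvg_dotpl; apply: (continuous_cvg _ (@cgrad zs) xt0).
apply: (cvgr_to_ge lim); apply: filterS (near_right01 R) => t /andP[t0 t1] /=.
have Xt : X (xt t) by rewrite /xt -vE; apply: convex_set_segment => //; rewrite ltW.
have xtB : xt t - zs = t *: v by rewrite /xt addrAC subrr add0r.
move: (xt t) Xt xtB => y Xy yB.
have := sol _ Xy; have := gL _ _ _ Xy Xy Xzs.
rewrite /bregman -(opprB y) yB.
(* Rewriting with [dotpE] diverges when unification can unfold [grad]. *)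
move: (grad d) => gd; rewrite !dotpE => h1 h2.
rewrite -(pmulr_rge0 _ t0); lra.
Qed.

(** Optimality of [w] is tested at [z'] and that of [z'] at [x]. Adding both to the acceptance test
    divided by [L] leaves an identity between Bregman terms. *)
Lemma trial_descent {R : realType} {n : nat} (X : set 'rV[R]_n)
    (d : 'rV[R]_n -> R) (g : 'rV[R]_n -> 'rV[R]_n) (mu L : R)
    (z w z' x : 'rV[R]_n) :
  convex_set X -> prox_function d -> 0 < L ->
  trial X d g mu L z w z' -> accepted d g L z w z' -> X x ->
  (1 + mu / L) * bregman d x z' <=
    bregman d x z + mu / L * (bregman d x w - bregman d z' w)
    - L^-1 * dotp (g w) (w - x).
Proof.
move=> cX [dd _ _] L0 [wmin zmin] acc Xx.
have [[Xw _] [Xz' _]] := (wmin, zmin).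
(* Expanding the divergences moves their gradients into the linear part; the terms constant in [u]
   are dropped. *)
have wopt : is_argmin X
    (fun u => dotp (L^-1 *: g z - grad d z) u + 1 * d u) w.
  split=> // y /(wmin.2 y); rewrite /bregman; move: (grad d) => gd; rewrite !dotpE; lra.
have zopt : is_argmin X
    (fun u => dotp (L^-1 *: g w - grad d z - (mu / L) *: grad d w) u
              + (1 + mu / L) * d u) z'.
  split=> // y /(zmin.2 y); rewrite /bregman; move: (grad d) => gd; rewrite !dotpE; lra.
have := argmin_first_order cX (dd w) wopt Xz'.
have := argmin_first_order cX (dd z') zopt Xx.
have : L^-1 * dotp (g z - g w) (z' - w) <= bregman d w z + bregman d z' w.
  by rewrite mulrC ler_pdivrMr// mulrC.
rewrite /bregman; move: (grad d) => gd; rewrite !dotpE; lra.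
Qed.

Lemma step_contraction {R : realType} {n : nat} (X : set 'rV[R]_n)
    (d : 'rV[R]_n -> R) (g : 'rV[R]_n -> 'rV[R]_n) (mu L Lk : R)
    (z w z' zs : 'rV[R]_n) :
  convex_set X -> prox_function d -> 0 < mu -> 0 < Lk ->
  rel_strongly_monotone X d mu g -> rel_smooth X d L g ->
  minty_solution X g zs ->
  trial X d g mu Lk z w z' -> accepted d g Lk z w z' ->
  bregman d zs z' <= (1 + mu / Lk)^-1 * bregman d zs z.
Proof.
move=> cX dprox mu0 Lk0 gmono gL sol tr acc.
have [[Xw _] _] := tr.
have [Xzs _] := sol.
have r0 : 0 < mu / Lk by rewrite divr_gt0.
rewrite mulrC ler_pdivlMr ?addr_gt0// mulrC.
apply: le_trans (trial_descent cX dprox Lk0 tr acc Xzs) _.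
have [_ cgrad _] := dprox.
have stamp := minty_stampacchia cX cgrad gL sol Xw.
have mono := gmono _ _ Xzs Xw.
have Vw := mulr_ge0 (ltW mu0) (bregman_ge0 zs w dprox).
have Vz' := mulr_ge0 (ltW r0) (bregman_ge0 w z' dprox).
(* Strong monotonicity between [zs] and [w], where [stamp] removes [g zs] and [bregman d w zs >= 0]
   is discarded. Divided by [Lk], this absorbs the term [mu / Lk * bregman d zs w] of the descent
   bound. *)
have : mu * bregman d zs w <= dotp (g w) (w - zs).
  by move: mono; rewrite dotpDl dotpNl; lra.
rewrite -(ler_pM2l (x := Lk^-1)) ?invr_gt0// => key.
lra.
Qed.

(** If [i = 0], then [Lk1 = Lk / 2]. Otherwise the trial with [Lk1 / 2] failed, whereas smoothness
    at [(z0, z, w0)] makes any trial with parameter at least [L] pass. *)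
Lemma adaptive_step_le {R : realType} {n : nat} (X : set 'rV[R]_n)
    (d : 'rV[R]_n -> R) (g : 'rV[R]_n -> 'rV[R]_n) (mu L Lk Lk1 : R)
    (z w z' : 'rV[R]_n) :
  prox_function d -> rel_smooth X d L g -> X z -> Lk <= 4 * L ->
  adaptive_step X d g mu Lk Lk1 z w z' -> Lk1 <= 2 * L.
Proof.
move=> dprox gL Xz Lk4 [[|i] [-> _ _ fail]]; first by rewrite expr0; lra.
have [w0 [z0 [[[Xw0 _] [Xz0 _]] nacc]]] := fail i (ltnSn i).
rewrite exprS -!mulrA ler_pM2l// leNgt mulrA; apply/negP => Lt.
apply: nacc; rewrite /accepted.
apply: (le_trans (gL _ _ _ Xz0 Xz Xw0)).
rewrite -mulrDr [_ + bregman d w0 z]addrC; apply: ler_wpM2r (ltW Lt).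
by rewrite addr_ge0 ?bregman_ge0.
Qed.

Theorem corollary1 (R : realType) (n : nat) (X : set 'rV[R]_n)
    (d : 'rV[R]_n -> R) (g : 'rV[R]_n -> 'rV[R]_n) (mu L L0 : R)
    (zs : 'rV[R]_n) (z w : nat -> 'rV[R]_n) (Ls : nat -> R)
    (X_closed : closed X) (X_convex : convex_set X)
    (d_prox : prox_function d)
    (mu_gt0 : 0 < mu) (L_gt0 : 0 < L) (L0_gt0 : 0 < L0)
    (g_mono : rel_strongly_monotone X d mu g)
    (g_smooth : rel_smooth X d L g)
    (zs_sol : minty_solution X g zs)
    (run : adaptive_method X d g mu L0 z w Ls) :
  forall k : nat,
    bregman d zs (z k.+1) <=
      (\prod_(0 <= i < k.+1) (1 + mu / Ls i.+1)^-1) * bregman d zs (z 0%N) /\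
    (L0 <= 4 * L ->
     bregman d zs (z k.+1) <=
       (1 + mu / (2 * L)) ^- k.+1 * bregman d zs (z 0%N)).
Proof.
have [[Xz0 _] Ls0 step] := run.
have Xz k : X (z k).
  by case: k => // k; have [i [_ [_ []]]] := step k.
have Ls_gt0 k : 0 < Ls k.
  elim: k => [|k IH]; first by rewrite Ls0.
  by have [i [-> _ _ _]] := step k; rewrite mulr_gt0 ?divr_gt0 ?exprn_gt0.
have V0 k := bregman_ge0 (z k) zs d_prox.
have contr k : bregman d zs (z k.+1) <=
    (1 + mu / Ls k.+1)^-1 * bregman d zs (z k).
  have [i [_ tr acc _]] := step k.
  exact: step_contraction g_mono g_smooth zs_sol tr acc.
have fac0 l : 0 < l -> 0 < 1 + mu / l by move=> l0; rewrite addr_gt0 ?divr_gt0.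
move=> k; split=> [|L04].
  elim: k => [|k IH]; first by rewrite big_nat1.
  apply: le_trans (contr _) _.
  rewrite big_nat_recr//= [_ * (_ + _)^-1]mulrC -mulrA.
  by rewrite ler_wpM2l// invr_ge0 ltW ?fac0.
(* One step can at best halve the parameter, so [Ls 1 >= L0 / 2]: the assumption [L0 <= 4 * L]
   starts the induction, and then [2 * L <= 4 * L] carries it on. *)
have Ls_le j : Ls j.+1 <= 2 * L.
  elim: j => [|j IH].
    by apply: (adaptive_step_le d_prox g_smooth _ _ (step 0%N)); rewrite ?Ls0.
  by apply: (adaptive_step_le d_prox g_smooth _ _ (step j.+1)) => //; lra.
have contr2 j : bregman d zs (z j.+1) <=
    (1 + mu / (2 * L))^-1 * bregman d zs (z j).
  (* The contraction factor increases with the parameter, so [2 * L] gives the worst case. *)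
  apply: le_trans (contr j) _; rewrite ler_wpM2r//.
  rewrite lef_pV2 ?posrE ?fac0 ?mulr_gt0//.
  by rewrite lerD2l ler_pM2l// lef_pV2 ?posrE ?mulr_gt0.
elim: k => [|k IH]; first by rewrite expr1.
apply: le_trans (contr2 _) _.
rewrite exprS [(_ * _ ^+ _)^-1]invfM -mulrA ler_wpM2l//.
by rewrite invr_ge0 ltW ?fac0 ?mulr_gt0.
Qed.
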